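(* Let $G$ be a finite simple graph on $n$ vertices, $K$ a field and $S=K[x_v : v\in V(G)]$. Suppose there exists an independent set $A$ of $G$ such that $NI(G)=(u_{v,G} : v\in A)$, where $u_{v,G}=\prod_{w\in N_G[v]}x_w$. Then (a) $\operatorname{pd}(S/NI(G))=\alpha(G)=|\mathcal{G}(NI(G))|$; (b) $\operatorname{reg}(S/NI(G))=\tau(G)=n-|\mathcal{G}(NI(G))|$.
   Context: $N_G[v]$ is the closed neighborhood of $v$ ($v$ together with its neighbors) and $NI(G)=(u_{v,G} : v\in V(G))$ is the closed neighborhood ideal. $\mathcal{G}(I)$ denotes the minimal set of monomial generators of a monomial ideal $I$. $\alpha(G)$ is the independence number and $\tau(G)$ the vertex cover number of $G$. $\operatorname{reg}$ is Castelnuovo–Mumford regularity, $\operatorname{pd}$ projective dimension; $K$ is an infinite field. *)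

(* Defs.v *)
From HB Require Import structures.
From mathcomp Require Import all_boot all_order all_algebra.
From mathcomp Require Import mpoly.
Set Implicit Arguments. Unset Strict Implicit. Unset Printing Implicit Defensive.
Import Order.TTheory GRing.Theory.
Local Open Scope ring_scope.

Definition simple_graph n (e : rel 'I_n) : Prop :=
  irreflexive e /\ ssrbool.symmetric e.

Definition closed_nbhd n (e : rel 'I_n) (v : 'I_n) : {set 'I_n} :=
  [set w | (w == v) || e v w].

Definition independent n (e : rel 'I_n) (A : {set 'I_n}) : bool :=
  [forall v in A, forall w in A, ~~ e v w].

Definition vertex_cover n (e : rel 'I_n) (C : {set 'I_n}) : bool :=
  [forall v, forall w, e v w ==> (v \in C) || (w \in C)].

Definition alpha n (e : rel 'I_n) : nat :=
  \max_(A : {set 'I_n} | independent e A) #|A|.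

(* vertex cover number tau(G) ([set: 'I_n] is always a cover) *)
Definition tau n (e : rel 'I_n) : nat :=
  \big[minn/n]_(C : {set 'I_n} | vertex_cover e C) #|C|.

Definition u_nbhd (K : fieldType) n (e : rel 'I_n) (v : 'I_n) : {mpoly K[n]} :=
  \prod_(w in closed_nbhd e v) 'X_w.

Definition ideal_gen (K : fieldType) n (P : pred 'I_n) (g : 'I_n -> {mpoly K[n]})
  : {mpoly K[n]} -> Prop :=
  fun p => exists c : 'I_n -> {mpoly K[n]}, p = \sum_(v | P v) c v * g v.

Definition NI (K : fieldType) n (e : rel 'I_n) : {mpoly K[n]} -> Prop :=
  ideal_gen predT (u_nbhd K e).

Definition mdivides n (m1 m2 : 'X_{1..n}) : Prop := forall i, (m1 i <= m2 i)%N.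

Definition min_mon_gen (K : fieldType) n (I : {mpoly K[n]} -> Prop)
  (m : 'X_{1..n}) : Prop :=
  I 'X_[m] /\ forall m' : 'X_{1..n}, I 'X_[m'] -> mdivides m' m -> m' = m.

(* homogeneous of degree d (the zero polynomial is homogeneous of every degree) *)
Definition homog_of (K : fieldType) n (d : nat) (p : {mpoly K[n]}) : Prop :=
  forall m, m \in msupp p -> mdeg m = d.

(* A graded free resolution of S/I of length len:
     0 -> F_len -> ... -> F_1 -> F_0 = S -> S/I -> 0,
   F_i = (+)_{j < b i} S(-a i j); the map F_{i+1} -> F_i is given (row-vector
   convention) by the matrix d i : 'M_(b i.+1, b i), each entry (d i) j k being
   homogeneous of degree a i.+1 j - a i k (and zero if that is negative). *)
Record graded_free_res (K : fieldType) n (I : {mpoly K[n]} -> Prop) (len : nat) := {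
  gfr_b : nat -> nat;
  gfr_a : nat -> nat -> nat;
  gfr_d : forall i, 'M[{mpoly K[n]}]_(gfr_b i.+1, gfr_b i);
  gfr_b0 : gfr_b 0 = 1%N;
  gfr_a0 : gfr_a 0 0 = 0%N;
  gfr_len : forall i, (len < i)%N -> gfr_b i = 0%N;
  gfr_graded : forall i (j : 'I_(gfr_b i.+1)) (k : 'I_(gfr_b i)),
      gfr_d i j k = 0 \/
      ((gfr_a i k <= gfr_a i.+1 j)%N /\
       homog_of (gfr_a i.+1 j - gfr_a i k) (gfr_d i j k));
  (* image of F_1 -> F_0 = S is I (F_0 has rank gfr_b 0 = 1, so k is its unique index) *)
  gfr_im0 : forall p : {mpoly K[n]},
      I p <-> exists v : 'rV[{mpoly K[n]}]_(gfr_b 1),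
        forall k : 'I_(gfr_b 0), (v *m gfr_d 0) 0 k = p;
  gfr_exact : forall i (w : 'rV[{mpoly K[n]}]_(gfr_b i.+1)),
      w *m gfr_d i = 0 <-> exists v : 'rV_(gfr_b i.+2), w = v *m gfr_d i.+1
}.

Definition has_gfr (K : fieldType) n (I : {mpoly K[n]} -> Prop) (len : nat) : Prop :=
  inhabited (graded_free_res I len).

Definition is_pd (K : fieldType) n (I : {mpoly K[n]} -> Prop) (p : nat) : Prop :=
  has_gfr I p /\ forall q, has_gfr I q -> (p <= q)%N.

Definition has_gfr_reg_le (K : fieldType) n (I : {mpoly K[n]} -> Prop) (r : nat) : Prop :=
  exists len, exists F : graded_free_res I len,
    forall i j, (j < gfr_b F i)%N -> (gfr_a F i j <= r + i)%N.

(* reg(S/I) = r : max_{i,j} (a_{ij} - i) over the minimal graded free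
   resolution, i.e. the least such bound over all graded free resolutions
   (the minimal one is a direct summand of any other). *)
Definition is_reg (K : fieldType) n (I : {mpoly K[n]} -> Prop) (r : nat) : Prop :=
  has_gfr_reg_le I r /\ forall r', has_gfr_reg_le I r' -> (r <= r')%N.

Definition infinite_field (K : fieldType) : Prop :=
  forall s : seq K, exists x : K, x \notin s.

(* Main.v *)
(* Each vertex [a] of [A] gives a variable dividing [u_a] and no other [u_b],
   [b] in [A]. Monomial ideals with such private variables are closed under the
   colon operation [I : u], so iterating the mapping cone over
   [0 -> S/(I : u)(- deg u) -> S/I -> S/(I + (u)) -> 0] resolves [S/NI(G)] in
   length [k = #|A|], with last module [S(-n)] of rank one and all shifts
   [a i j <= (n - k) + i]. As the last shift exceeds those of the previous
   module, comparing with this resolution shows that any graded resolution has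
   a generator of degree at least [n] in homological degree [k]. Thus pd = k
   and reg = n - k. Finally [alpha = k]: if [N[a]] is contained in [N[v]] then
   [v] lies in [N[a]], and the vertices [v] with the same [a] are pairwise
   adjacent. *)

Require Import Defs.
From HB Require Import structures.
From mathcomp Require Import all_boot all_order all_algebra.
From mathcomp Require Import mpoly zify.
Set Implicit Arguments. Unset Strict Implicit. Unset Printing Implicit Defensive.
Import GRing.Theory.
Local Open Scope ring_scope.

(** * Polynomials with restricted support, and graded matrix entries *)

Section SupportedPolynomials.
Variables (K : fieldType) (n : nat).
Implicit Types (p q : {mpoly K[n]}) (P Q : pred 'X_{1..n}) (m : 'X_{1..n}).

(** This one test expresses homogeneity, membership in a monomial ideal and absence of a constant
    term, according to [P]. *)
Definition supp_in P p : bool := all P (msupp p).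

Lemma supp_inP P p : reflect {in msupp p, forall m, P m} (supp_in P p).
Proof. exact: allP. Qed.

Lemma sub_supp_in P Q p : subpred P Q -> supp_in P p -> supp_in Q p.
Proof. by move=> sPQ; apply: sub_all => m; apply: sPQ. Qed.

Lemma supp_in0 P : supp_in P 0.
Proof. by rewrite /supp_in msupp0. Qed.

Lemma supp_inD P p q : supp_in P p -> supp_in P q -> supp_in P (p + q).
Proof.
move=> /supp_inP Pp /supp_inP Pq; apply/supp_inP => m /msuppD_le.
by rewrite mem_cat => /orP[/Pp|/Pq].
Qed.

Lemma supp_inN P p : supp_in P (- p) = supp_in P p.
Proof. exact/perm_all/msuppN. Qed.

Lemma supp_inB P p q : supp_in P p -> supp_in P q -> supp_in P (p - q).
Proof. by move=> Pp Pq; rewrite supp_inD ?supp_inN. Qed.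

Lemma supp_in_sum P (J : eqType) (r : seq J) (F : J -> {mpoly K[n]}) :
  {in r, forall j, supp_in P (F j)} -> supp_in P (\sum_(j <- r) F j).
Proof.
move=> PF; rewrite big_seq; apply: (big_ind (supp_in P)) => //; first exact: supp_in0.
exact: supp_inD.
Qed.

Lemma supp_inM P1 P2 P p q :
  (forall m1 m2, P1 m1 -> P2 m2 -> P (m1 + m2)%MM) ->
  supp_in P1 p -> supp_in P2 q -> supp_in P (p * q).
Proof.
move=> P12 /supp_inP Pp /supp_inP Pq; apply/supp_inP => m /msuppM_le.
by case/allpairsP => -[m1 m2] /= [/Pp ? /Pq ? ->]; apply: P12.
Qed.

Lemma supp_inZ P c p : supp_in P p -> supp_in P (c *: p).
Proof. by move=> /supp_inP Pp; apply/supp_inP => m /msuppZ_le/Pp. Qed.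

Lemma supp_inX P m : supp_in P 'X_[m] = P m.
Proof. by rewrite /supp_in msuppX /= andbT. Qed.

Lemma supp_inMX P p m : supp_in P (p * 'X_[m]) = supp_in (fun m' => P (m + m')%MM) p.
Proof. by rewrite /supp_in (perm_all _ (msuppMX p m)) all_map. Qed.

Lemma supp_in_eq0 P p : supp_in P p -> supp_in (predC P) p -> p = 0.
Proof.
move=> /supp_inP Pp /supp_inP nPp; apply: msuppnil0.
case E: (msupp p) => [//|m r].
have mp : m \in msupp p by rewrite E mem_head.
by have := nPp m mp; rewrite /= Pp.
Qed.

Definition supp_proj P p : {mpoly K[n]} := \sum_(m <- msupp p | P m) p@_m *: 'X_[m].

Lemma supp_in_proj P p : supp_in P (supp_proj P p).
Proof.
rewrite /supp_proj; apply: (big_ind (supp_in P)) => [||m Pm];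
  [exact: supp_in0|exact: supp_inD|].
by rewrite supp_inZ ?supp_inX.
Qed.

Lemma supp_in_projC P p : supp_in (predC P) (p - supp_proj P p).
Proof.
rewrite {1}[p]mpolyE (bigID P) /= addrAC subrr add0r.
apply: (big_ind (supp_in (predC P))) => [||m Pm]; [exact: supp_in0|exact: supp_inD|].
by rewrite supp_inZ ?supp_inX.
Qed.

Lemma supp_in_ideal_neq0 p q :
  supp_in (fun m => m != 0%MM) p -> supp_in (fun m => m != 0%MM) (p * q).
Proof.
move=> Pp; apply: (supp_inM (P2 := predT)) Pp _; last by apply/allP.
by move=> m1 m2 nz _; rewrite mnmD_eq0 (negPf nz).
Qed.

(* The entry of a degree-0 map from the generator of S(-t) to that of S(-s). *)
Definition graded_entry (s t : nat) : pred {mpoly K[n]} :=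
  supp_in (fun m => s + mdeg m == t)%N.

(** The additive form avoids truncated subtraction: for [s > t] no monomial qualifies, so only 0
    passes. *)
Lemma graded_entryP s t p :
  reflect (p = 0 \/ (s <= t)%N /\ homog_of (t - s) p) (graded_entry s t p).
Proof.
apply: (iffP (supp_inP _ _)) => [Pp | [-> m|[le_st hp] m /hp ->]].
- have [->|nz_p] := eqVneq p 0; first by left.
  right; split=> [|m /Pp/eqP<-]; last by rewrite addKn.
  case E: (msupp p) nz_p => [|m r]; first by rewrite (msuppnil0 E) eqxx.
  have /eqP <- : (s + mdeg m == t)%N by apply: Pp; rewrite E mem_head.
  by rewrite leq_addr.
- by rewrite msupp0.
- by rewrite subnKC.
Qed.

Lemma graded_entryM s t r p q :
  graded_entry s t p -> graded_entry r s q -> graded_entry r t (p * q).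
Proof.
apply: supp_inM => m1 m2 /eqP <- /eqP <-.
by rewrite mdegD -addnA [(mdeg m2 + _)%N]addnC.
Qed.

Lemma graded_entryD2 u s t p :
  graded_entry (s + u) (t + u) p = graded_entry s t p.
Proof. by apply: eq_all => m; rewrite addnAC eqn_add2r. Qed.

Lemma graded_entryN s t p : graded_entry s t (- p) = graded_entry s t p.
Proof. exact: supp_inN. Qed.

Lemma graded_entry_pos s t p :
  (s < t)%N -> graded_entry s t p -> supp_in (fun m => m != 0%MM) p.
Proof.
move=> lt_st; apply: sub_supp_in => m /eqP def_t; apply: contraTneq lt_st => m0.
by rewrite -def_t m0 mdeg0 addn0 ltnn.
Qed.

End SupportedPolynomials.

(** Serves to build chain maps degree by degree, where the matrix type depends on [i]. Boolean
    conditions let [xchoose] select each step. *)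
Lemma dependent_choice (T : nat -> choiceType) (P : forall i, pred (T i))
    (R : forall i, T i -> T i.+1 -> bool) (x0 : T 0%N) :
  P 0%N x0 ->
  (forall i x, P i x -> exists y, P i.+1 y && R i x y) ->
  exists f : forall i, T i,
    [/\ f 0%N = x0, forall i, P i (f i) & forall i, R i (f i) (f i.+1)].
Proof.
move=> Px0 stepP.
pose step i (x : {x | P i x}) : {y | P i.+1 y} :=
  exist _ (xchoose (stepP i _ (valP x)))
          (proj1 (andP (xchooseP (stepP i _ (valP x))))).
pose g := nat_rect (fun i => {x | P i x}) (exist _ x0 Px0) step.
exists (fun i => val (g i)); split=> // i; first exact: valP.
by have /andP[] := xchooseP (stepP i _ (valP (g i))).
Qed.

(** * Graded free resolutions: lifting and comparison *)

Section Resolutions.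
Variables (K : fieldType) (n : nat).
Local Notation S := {mpoly K[n]}.
Implicit Type I : S -> Prop.

Section OneResolution.
Variables (I : S -> Prop) (l : nat) (F : graded_free_res I l).

Lemma gfr_entry i (j : 'I_(gfr_b F i.+1)) (k : 'I_(gfr_b F i)) :
  graded_entry (gfr_a F i k) (gfr_a F i.+1 j) (gfr_d F i j k).
Proof. exact/graded_entryP/gfr_graded. Qed.

Lemma gfr_dd i : gfr_d F i.+1 *m gfr_d F i = 0.
Proof.
apply/row_matrixP => j; rewrite row_mul row0.
by apply/gfr_exact; exists (delta_mx 0 j); rewrite rowE.
Qed.

Lemma gfr_exact_mx i r (M : 'M[S]_(r, gfr_b F i.+1)) :
  M *m gfr_d F i = 0 -> forall j, exists v, row j M = v *m gfr_d F i.+1.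
Proof. by move=> M0 j; apply/gfr_exact; rewrite -row_mul M0 row0. Qed.

Lemma gfr_a_bot (k : 'I_(gfr_b F 0)) : gfr_a F 0 k = 0%N.
Proof.
have /eqP -> : k == 0%N :> nat.
  by rewrite -leqn0 -ltnS -[X in (_ < X)%N](gfr_b0 F) ltn_ord.
exact: gfr_a0.
Qed.

Lemma gfr_index0 (k k' : 'I_(gfr_b F 0)) : k = k'.
Proof.
have eq0 (k1 : 'I_(gfr_b F 0)) : k1 = 0%N :> nat.
  by apply/eqP; rewrite -leqn0 -ltnS -[X in (_ < X)%N](gfr_b0 F) ltn_ord.
by apply: val_inj; rewrite /= !eq0.
Qed.

(* Any preimage can be replaced by its homogeneous part. *)
Lemma graded_lift_row i (w : 'rV[S]_(gfr_b F i)) t :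
  (exists v, w = v *m gfr_d F i) ->
  (forall k : 'I_(gfr_b F i), graded_entry (gfr_a F i k) t (w 0 k)) ->
  exists2 v, w = v *m gfr_d F i &
    forall j : 'I_(gfr_b F i.+1), graded_entry (gfr_a F i.+1 j) t (v 0 j).
Proof.
case=> v ->{w} grw.
pose part (j : 'I_(gfr_b F i.+1)) :=
  supp_proj (fun m => gfr_a F i.+1 j + mdeg m == t)%N (v 0 j).
exists (\row_j part j) => [|j]; last by rewrite mxE; apply: supp_in_proj.
apply/rowP => k; apply/eqP; rewrite -subr_eq0; apply/eqP.
(* The error is supported in degree [t], as are both images, and outside it, as it comes from the
   discarded components. *)
apply: (supp_in_eq0 (P := (fun m => gfr_a F i k + mdeg m == t)%N)).
  apply: supp_inB (grw k) _; rewrite mxE; apply: supp_in_sum => j _.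
  by rewrite mxE; apply: graded_entryM (supp_in_proj _ _) (gfr_entry j k).
rewrite !mxE -sumrB; apply: supp_in_sum => j _.
rewrite mxE -mulrBl; apply: supp_inM (supp_in_projC _ _) (gfr_entry j k).
move=> m1 m2 /= ne_t /eqP def_j; apply: contraNneq ne_t => <-.
by rewrite mdegD -def_j -addnA [(mdeg m2 + _)%N]addnC.
Qed.

Lemma graded_lift i r (M : 'M[S]_(r, gfr_b F i)) (t : 'I_r -> nat) :
  (forall j, exists v, row j M = v *m gfr_d F i) ->
  (forall j (k : 'I_(gfr_b F i)), graded_entry (gfr_a F i k) (t j) (M j k)) ->
  exists2 N, M = N *m gfr_d F i &
    forall j (k : 'I_(gfr_b F i.+1)), graded_entry (gfr_a F i.+1 k) (t j) (N j k).
Proof.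
move=> liftM grM.
have rowN j : exists v : 'rV_(gfr_b F i.+1),
    row j M = v *m gfr_d F i /\
    forall k : 'I_(gfr_b F i.+1), graded_entry (gfr_a F i.+1 k) (t j) (v 0 k).
  have [|v] := graded_lift_row (t := t j) (liftM j); last by exists v.
  by move=> k; rewrite mxE.
have [N defN] := fin_all_exists rowN.
exists (\matrix_j N j) => [|j k]; last by rewrite mxE; apply: (defN j).2.
by apply/row_matrixP => j; rewrite row_mul rowK (defN j).1.
Qed.

End OneResolution.

Section Comparison.
Variables (I J : S -> Prop) (l l' : nat).
Variables (T : graded_free_res I l) (F : graded_free_res J l').

(** Multiplication by [u] induces a degree-0 map from S/I(-s) to S/J, which lifts to the
    resolutions. The case [u = 1] compares two resolutions; a monomial [u] feeds the mapping
    cone. *)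
Lemma comparison_map (u : S) s :
  graded_entry 0 s u -> (forall p, I p -> J (p * u)) ->
  exists f : forall i, 'M[S]_(gfr_b T i, gfr_b F i),
    [/\ f 0%N = const_mx u,
        forall i, gfr_d T i *m f i = f i.+1 *m gfr_d F i
      & forall i (j : 'I_(gfr_b T i)) (k : 'I_(gfr_b F i)),
          graded_entry (gfr_a F i k) (gfr_a T i j + s) (f i j k)].
Proof.
move=> gr_u IJ.
(* Besides gradedness the invariant records that [gfr_d T i *m x] consists of cycles, which is what
   exactness of [F] needs to produce the next map. *)
pose P i (x : 'M[S]_(gfr_b T i, gfr_b F i)) :=
  [forall j : 'I_(gfr_b T i), forall k : 'I_(gfr_b F i),
     graded_entry (gfr_a F i k) (gfr_a T i j + s) (x j k)] &&
  match i return 'M[S]_(gfr_b T i, gfr_b F i) -> bool with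
  | 0 => fun x => x == const_mx u
  | i'.+1 => fun x => gfr_d T i'.+1 *m x *m gfr_d F i' == 0
  end x.
pose R i x (y : 'M[S]_(gfr_b T i.+1, gfr_b F i.+1)) :=
  gfr_d T i *m x == y *m gfr_d F i.
have [||f [f0 Pf Rf]] := @dependent_choice _ P R (const_mx u).
- rewrite /P eqxx andbT; apply/forallP => j; apply/forallP => k.
  by rewrite mxE !gfr_a_bot.
- move=> i x /andP[/forallP grx Qx].
  have lift_x j : exists v, row j (gfr_d T i *m x) = v *m gfr_d F i.
    case: i => [|i] in x grx Qx j *; last exact/gfr_exact_mx/eqP.
    (* In degree 0 the lift comes from [IJ] instead: the entries of [gfr_d T 0] lie in [I], so their
       multiples by [u] lie in [J]. *)
    have k0 : 'I_(gfr_b T 0) by rewrite gfr_b0; exact: ord0.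
    have : I (gfr_d T 0 j k0).
      apply/(gfr_im0 T); exists (delta_mx 0 j) => k.
      by rewrite -rowE mxE (gfr_index0 k k0).
    move=> /IJ /(gfr_im0 F)[v def_v]; exists v; apply/rowP => k.
    rewrite def_v !mxE (bigD1 k0) //= big1 => [|k'].
      by rewrite (eqP Qx) mxE addr0.
    by rewrite (gfr_index0 k' k0) eqxx.
  have [|y def_y gry] := graded_lift (t := fun j : 'I_(gfr_b T i.+1) =>
    (gfr_a T i.+1 j + s)%N) lift_x.
    move=> j k; rewrite mxE; apply: supp_in_sum => k' _.
    apply: graded_entryM (forallP (grx k') k).
    by rewrite graded_entryD2 gfr_entry.
  exists y; rewrite /P /R def_y eqxx andbT; apply/andP; split.
    by apply/forallP => j; apply/forallP.
  by rewrite -mulmxA -def_y mulmxA gfr_dd mul0mx.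
exists f; split=> // i; first exact/eqP/Rf.
by move=> j k; have /andP[/forallP/(_ j)/forallP] := Pf i.
Qed.

End Comparison.

(* [phi : T -> F] and [psi : F -> T] lift the identity, so [psi phi] is
   homotopic to the identity of [T]. At the end [T_k] the homotopy is [d h],
   whose coefficients on [j0] have no constant term; hence neither can those of
   [phi] all vanish at the origin, and [phi] is graded. *)
Lemma top_degree_bound I l l' (T : graded_free_res I l) (F : graded_free_res I l')
    k (j0 : 'I_(gfr_b T k)) :
  (0 < k)%N -> gfr_b T k.+1 = 0%N ->
  (forall j : 'I_(gfr_b T k.-1), (gfr_a T k.-1 j < gfr_a T k j0)%N) ->
  exists2 j, (j < gfr_b F k)%N & (gfr_a T k j0 <= gfr_a F k j)%N.
Proof.
case: k j0 => //= k j0 _ end_T lt_a.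
have gr1 : graded_entry 0 0 (1 : S) by rewrite /graded_entry -mpolyX0 supp_inX mdeg0.
have lift1 p : I p -> I (p * 1) by rewrite mulr1.
have [phi [phi0 phid grphi]] := comparison_map T F gr1 lift1.
have [psi [psi0 psid _]] := comparison_map F T gr1 lift1.
pose g i := phi i *m psi i - 1%:M.
have dg i : gfr_d T i *m g i = g i.+1 *m gfr_d T i.
  by rewrite mulmxBr mulmxBl mulmxA phid -!mulmxA psid mulmx1 mul1mx.
have g0 : g 0%N = 0.
  apply/matrixP => j j'; rewrite /g phi0 psi0 !mxE.
  under eq_bigr do rewrite !mxE mulr1.
  rewrite (gfr_index0 j j').
  by rewrite sumr_const card_ord gfr_b0 eqxx subrr.
(* The induction keeps only the cycle condition: exactness turns it into the next homotopy, starting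
   from [g 0 = 0]. *)
have [h hd] : exists h : 'M[S]_(gfr_b T k, gfr_b T k.+1),
    (g k.+1 - gfr_d T k *m h) *m gfr_d T k = 0.
  elim: (k) => [|i [h hd]].
    by exists 0; rewrite mulmx0 subr0 -dg g0 mulmx0.
  have /fin_all_exists[h' h'd] := gfr_exact_mx hd.
  have {}h'd : g i.+1 - gfr_d T i *m h = (\matrix_j h' j) *m gfr_d T i.+1.
    by apply/row_matrixP => j; rewrite row_mul rowK.
  exists (\matrix_j h' j); rewrite mulmxBl -dg -mulmxA -h'd (mulmxBr _ (g _)) subKr.
  by rewrite mulmxA gfr_dd mul0mx.
have {hd} def_g : g k.+1 = gfr_d T k *m h.
  apply/eqP; rewrite -subr_eq0; apply/eqP/row_matrixP => j; rewrite row0.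
  have [v ->] := gfr_exact_mx hd j.
  by apply/rowP => i; rewrite !mxE big1 // => -[x ltx]; exfalso; rewrite end_T in ltx.
case: (pickP (fun j : 'I_(gfr_b F k.+1) => gfr_a T k.+1 j0 <= gfr_a F k.+1 j)%N).
  by move=> j le_j; exists j.
move=> small; have : supp_in (fun m => m != 0%MM) (1 : S); last first.
  by rewrite -mpolyX0 supp_inX eqxx.
have -> : 1 = (phi k.+1 *m psi k.+1) j0 j0 - (gfr_d T k *m h) j0 j0.
  by rewrite -def_g /g [X in _ - X]mxE [(- 1%:M) _ _]mxE [1%:M _ _]mxE eqxx subKr.
apply: supp_inB; rewrite mxE; apply: supp_in_sum => j _; apply: supp_in_ideal_neq0.
  apply: graded_entry_pos (grphi _ _ _); rewrite addn0 ltnNge.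
  by rewrite small.
exact: graded_entry_pos (lt_a j) (gfr_entry j0 j).
Qed.

(** * The mapping cone of multiplication by [u] *)

Section MappingCone.
Variables (I J I' : S -> Prop) (l l' : nat).
Variables (G : graded_free_res I l) (F : graded_free_res J l').
Variables (u : S) (s : nat).
Hypothesis gr_u : graded_entry 0 s u.
Hypothesis colonE : forall p, J p <-> I (p * u).
Hypothesis sumE : forall p, I' p <-> exists q y, I q /\ p = q + y * u.

(** In degree i+1 the cone is the sum of G_{i+1} and F_i(-s), with the generators of [G] listed
    first. *)
Definition cone_b i : nat :=
  if i is i'.+1 then gfr_b G i'.+1 + gfr_b F i' else gfr_b G 0.

Definition cone_a i j : nat :=
  if i is i'.+1 then
    if (j < gfr_b G i)%N then gfr_a G i j else (gfr_a F i' (j - gfr_b G i) + s)%N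
  else gfr_a G 0 j.

(** Rows are sources, so [f] sits in the lower left block; the sign on [gfr_d F] makes consecutive
    maps compose to 0. *)
Definition cone_d (f : forall i, 'M[S]_(gfr_b F i, gfr_b G i)) i :
    'M[S]_(cone_b i.+1, cone_b i) :=
  match i with
  | 0 => col_mx (gfr_d G 0) (f 0%N)
  | i'.+1 => block_mx (gfr_d G i'.+1) 0 (f i'.+1) (- gfr_d F i')
  end.

Lemma cone_a_l i (j : 'I_(gfr_b G i.+1)) :
  cone_a i.+1 (lshift (gfr_b F i) j) = gfr_a G i.+1 j.
Proof. by rewrite /= ltn_ord. Qed.

Lemma cone_a_r i (j : 'I_(gfr_b F i)) :
  cone_a i.+1 (rshift (gfr_b G i.+1) j) = (gfr_a F i j + s)%N.
Proof. by rewrite /= ltnNge leq_addr addKn. Qed.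

(** Once the [F]-component is a boundary, correcting the [G]-component through [f] leaves a cycle of
    [G], hence a boundary. This serves exactness in degree 1 and above alike. *)
Lemma cone_exact_step (f : forall i, 'M[S]_(gfr_b F i, gfr_b G i)) i
    (g : 'rV_(gfr_b G i.+1)) (y : 'rV_(gfr_b F i)) (y' : 'rV_(gfr_b F i.+1)) :
  gfr_d F i *m f i = f i.+1 *m gfr_d G i ->
  g *m gfr_d G i + y *m f i = 0 -> y = y' *m gfr_d F i ->
  exists v : 'rV_(cone_b i.+2), row_mx g y = v *m cone_d f i.+1.
Proof.
move=> fd gy0 def_y.
have [g' def_g] : exists g', g + y' *m f i.+1 = g' *m gfr_d G i.+1.
  by apply/gfr_exact; rewrite mulmxDl -mulmxA -fd mulmxA -def_y.
exists (row_mx g' (- y')); rewrite /= mul_row_block -def_g mulNmx addrK.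
by rewrite mulmx0 add0r mulmxN mulNmx opprK def_y.
Qed.

(** [colonE] gives the chain map and exactness in degree 1, [sumE] the image in degree 0. The bound
    on [l'] is strict because [F] moves up one homological degree. *)
Lemma mapping_cone L : (l <= L)%N -> (l' < L)%N ->
  exists C : graded_free_res I' L, gfr_b C = cone_b /\ gfr_a C = cone_a.
Proof.
move=> le_lL lt_lL.
have [f [f0 fd gr_f]] := comparison_map F G gr_u (fun p => proj1 (colonE p)).
have b0 : cone_b 0 = 1%N := gfr_b0 G.
have a0 : cone_a 0 0 = 0%N := gfr_a0 G.
have blen i : (L < i)%N -> cone_b i = 0%N.
  by case: i => [//|i] lt_Li /=; rewrite !gfr_len //; lia.
have graded i (j : 'I_(cone_b i.+1)) (k : 'I_(cone_b i)) :
    graded_entry (cone_a i k) (cone_a i.+1 j) (cone_d f i j k).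
  case: i j k => [|i] j k.
    rewrite -[j]splitK; case: (split j) => {}j; rewrite /unsplit.
      by rewrite cone_a_l col_mxEu gfr_entry.
    rewrite cone_a_r col_mxEd; exact: gr_f.
  rewrite -[j]splitK -[k]splitK; case: (split j) (split k) => {}j [] {}k;
    rewrite /unsplit.
  - by rewrite !cone_a_l block_mxEul gfr_entry.
  - by rewrite cone_a_l cone_a_r block_mxEur mxE; apply: supp_in0.
  - rewrite cone_a_l cone_a_r block_mxEdl; exact: gr_f.
  - by rewrite !cone_a_r block_mxEdr mxE graded_entryN graded_entryD2 gfr_entry.
have dd i : cone_d f i.+1 *m cone_d f i = 0.
  case: i => [|i] /=.
    by rewrite mul_block_col mul0mx addr0 gfr_dd mulNmx fd subrr col_mx0.
  rewrite mulmx_block !mul0mx !mulmx0 !gfr_dd !addr0 add0r !mulNmx !mulmxN opprK.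
  by rewrite fd subrr gfr_dd block_mx0.
have k0 : 'I_(gfr_b G 0) by rewrite gfr_b0; exact: ord0.
have j0 : 'I_(gfr_b F 0) by rewrite gfr_b0; exact: ord0.
have mul_f0 (y : 'rV_(gfr_b F 0)) k : (y *m f 0%N) 0 k = y 0 j0 * u.
  rewrite mxE (bigD1 j0) //= big1 => [|j]; first by rewrite f0 mxE addr0.
  by rewrite (gfr_index0 j j0) eqxx.
have im0 p : I' p <-> exists v : 'rV[S]_(cone_b 1),
    forall k : 'I_(cone_b 0), (v *m cone_d f 0) 0 k = p.
  split=> [/sumE[q [y [/(gfr_im0 G)[v def_q] ->]]] | [v def_p]].
    exists (row_mx v (const_mx y)) => k.
    by rewrite /= mul_row_col mxE def_q mul_f0 mxE.
  apply/sumE; exists ((lsubmx v *m gfr_d G 0) 0 k0), (rsubmx v 0 j0); split.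
    by apply/(gfr_im0 G); exists (lsubmx v) => k; rewrite (gfr_index0 k k0).
  by rewrite -(def_p k0) -{1}[v]hsubmxK /= mul_row_col mxE mul_f0.
have exact i (w : 'rV[S]_(cone_b i.+1)) :
    w *m cone_d f i = 0 <-> exists v : 'rV_(cone_b i.+2), w = v *m cone_d f i.+1.
  split=> [|[v ->]]; last by rewrite -mulmxA dd mulmx0.
  case: i w => [|i] w; rewrite -[w]hsubmxK /=.
    rewrite mul_row_col => gy0.
    (* The cycle equation says that this entry times [u] is minus an element of [I]. *)
    have : J (rsubmx w 0 j0).
      apply/colonE/(gfr_im0 G); exists (- lsubmx w) => k.
      rewrite -(mul_f0 _ k) mulNmx; apply/eqP; rewrite mxE eq_sym -addr_eq0 addrC.
      by move/rowP/(_ k): gy0; rewrite !mxE => ->.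
    move=> /(gfr_im0 F)[y' def_y]; apply: cone_exact_step (fd 0%N) gy0 _.
    by apply/rowP => j; rewrite (gfr_index0 j j0); apply/esym.
  rewrite mul_row_block mulmx0 add0r mulmxN -[0]row_mx0 => /eq_row_mx[gy0 /eqP].
  rewrite oppr_eq0 => /eqP/gfr_exact[y' def_y].
  exact: cone_exact_step (fd _) gy0 def_y.
have gfr i (j : 'I_(cone_b i.+1)) (k : 'I_(cone_b i)) :=
  graded_entryP _ _ _ (graded i j k).
by exists (Build_graded_free_res b0 a0 blen gfr im0 exact).
Qed.

End MappingCone.
End Resolutions.

(** * Monomial ideals, colons and lcm degrees *)

Section MonomialIdeals.
Variables (K : fieldType) (n : nat).
Local Notation S := {mpoly K[n]}.
Implicit Types (ms : seq 'X_{1..n}) (u m : 'X_{1..n}) (p q : S).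

Definition monomial_ideal ms p : bool :=
  supp_in (fun m => has (fun g => g <= m)%MM ms) p.

(** Truncated subtraction of exponents is division of [g] by gcd(g, u), and [g] divides [m u]
    exactly when that quotient divides [m]. *)
Lemma monomial_ideal_colon ms u p :
  monomial_ideal [seq (g - u)%MM | g <- ms] p = monomial_ideal ms (p * 'X_[u]).
Proof.
rewrite /monomial_ideal supp_inMX; apply: eq_all => m; rewrite has_map.
apply: eq_has => g /=; apply/mnm_lepP/mnm_lepP => le_g i.
  by have := le_g i; rewrite mnmBE mnmDE leq_subLR.
by have := le_g i; rewrite mnmBE mnmDE leq_subLR.
Qed.

Lemma monomial_ideal_cons ms u p :
  monomial_ideal (u :: ms) p <->
  exists q y, monomial_ideal ms q /\ p = q + y * 'X_[u].
Proof.
split=> [/supp_inP Ip | [q [y [Iq ->]]]]; last first.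
  apply: supp_inD; first by apply: sub_supp_in Iq => m /= ->; rewrite orbT.
  rewrite supp_inMX; apply/supp_inP => m _ /=; apply/orP; left; exact: lem_addr.
rewrite [p]mpolyE big_seq; apply: (big_ind (fun p =>
  exists q y, monomial_ideal ms q /\ p = q + y * 'X_[u])) => [|p1 p2|m /Ip].
- by exists 0, 0; rewrite mul0r addr0; split=> //; apply: supp_in0.
- move=> [q1 [y1 [I1 ->]]] [q2 [y2 [I2 ->]]]; exists (q1 + q2), (y1 + y2).
  by rewrite mulrDl addrACA; split=> //; apply: supp_inD.
case/orP => [le_um | Im].
  exists 0, (p@_m *: 'X_[m - u]); rewrite add0r -scalerAl -mpolyXD submK //.
  by split=> //; apply: supp_in0.
exists (p@_m *: 'X_[m]), 0; rewrite mul0r addr0; split=> //.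
by apply: supp_inZ; rewrite supp_inX.
Qed.

(** The degree of the lcm of the monomials [f a], [a] in [s]. *)
Definition lcm_deg (s : seq 'I_n) (f : 'I_n -> 'X_{1..n}) : nat :=
  \sum_(i < n) \max_(a <- s) f a i.

Lemma lcm_deg_cons (a : 'I_n) s f :
  lcm_deg (a :: s) f = (lcm_deg s (fun b => f b - f a)%MM + mdeg (f a))%N.
Proof.
rewrite /lcm_deg mdegE -big_split /=; apply: eq_bigr => i _; rewrite big_cons.
elim: s => [|b s IHs]; first by rewrite !big_nil maxn0.
by rewrite !big_cons mnmBE; lia.
Qed.

(** The private variable of [a] enters the lcm only with [f a]. *)
Lemma lcm_deg_lt (a : 'I_n) (s : seq 'I_n) (f : 'I_n -> 'X_{1..n}) :
  f a a = 1%N -> {in s, forall b, f b a = 0%N} -> (lcm_deg s f < lcm_deg (a :: s) f)%N.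
Proof.
move=> faa fba; rewrite /lcm_deg (bigD1 a) //= [in X in (_ < X)%N](bigD1 a) //=.
rewrite big_cons faa big1_seq => [|b /andP[_ /fba]] //; rewrite add0n maxn0 add1n ltnS.
by apply: leq_sum => i _; rewrite big_cons leq_maxr.
Qed.

(* Adding the generators one at a time, both [I] and the colon ideal
   [I : f a] are again generated by monomials with private variables. *)
Lemma private_variables_res (s : seq 'I_n) (f : 'I_n -> 'X_{1..n}) (I : S -> Prop) :
  uniq s -> {in s &, forall a b : 'I_n, f a b = (a == b)} ->
  (forall p, I p <-> monomial_ideal [seq f a | a <- s] p) ->
  exists T : graded_free_res I (size s),
    [/\ gfr_b T (size s) = 1%N, gfr_a T (size s) 0 = lcm_deg s f
      & forall i j, (j < gfr_b T i)%N -> (gfr_a T i j + size s <= lcm_deg s f + i)%N].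
Proof.
elim: s f I => [|a s IHs] f I /=.
  move=> _ _ IE.
  have exact i (w : 'rV[S]_0) :
      w *m (0 : 'M_(0, i)) = 0 <-> exists v : 'rV[S]_0, w = v *m 0.
    by split=> _; [exists 0; apply/rowP => -[] | rewrite mulmx0].
  have I0 p : I p <-> exists v : 'rV[S]_0, forall k, (v *m (0 : 'M_(0, 1))) 0 k = p.
    split=> [/IE /supp_inP p0 | [v /(_ 0) <-]].
      exists 0 => k; rewrite mul0mx mxE; apply/esym/msuppnil0.
      by case E: (msupp p) p0 => [//|m r] /(_ m (mem_head _ _)).
    by apply/IE; rewrite mulmx0 mxE; apply: supp_in0.
  pose b i : nat := if i is 0 then 1 else 0.
  have len i : (0 < i)%N -> b i = 0%N by case: i.
  have graded i (j : 'I_(b i.+1)) (k : 'I_(b i)) : (0 : 'M[S]_(b i.+1, b i)) j k = 0 \/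
      ((0 <= 0)%N /\ homog_of (0 - 0) ((0 : 'M[S]_(b i.+1, b i)) j k)) by case: j.
  exists (@Build_graded_free_res _ _ I 0 b (fun _ _ => 0%N)
    (fun i => 0) erefl erefl len graded I0 (fun i => exact (b i))).
  rewrite /lcm_deg big1 => [|i _]; last by rewrite big_nil.
  by split.
case/andP=> s'a uniq_s f_priv IE.
have faa : f a a = 1%N by rewrite f_priv ?mem_head ?eqxx.
have fba : {in s, forall b : 'I_n, f b a = 0%N}.
  move=> b sb; rewrite f_priv ?mem_head ?in_cons ?sb ?orbT //.
  by case: eqP sb s'a => // -> ->.
have fab : {in s, forall b : 'I_n, f a b = 0%N}.
  move=> b sb; rewrite f_priv ?mem_head ?in_cons ?sb ?orbT //.
  by case: eqP sb s'a => // -> ->.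
have f_priv_s : {in s &, forall b c : 'I_n, f b c = (b == c)}.
  by move=> b c sb sc; rewrite f_priv ?in_cons ?sb ?sc ?orbT.
have [//|G [bG aG leG]] := IHs f (monomial_ideal [seq f b | b <- s]) uniq_s f_priv_s.
(* Dividing by [f a] keeps the private variables of [s], since [f a] involves none of them. *)
have [|//|F [bF aF leF]] := IHs (fun b => f b - f a)%MM
  (monomial_ideal [seq (f b - f a)%MM | b <- s]) uniq_s.
  by move=> b c sb sc; rewrite mnmBE fab // subn0 f_priv_s.
have colon p : monomial_ideal [seq (f b - f a)%MM | b <- s] p <->
    monomial_ideal [seq f b | b <- s] (p * 'X_[f a]).
  by rewrite -monomial_ideal_colon -map_comp.
have sum p : I p <->
    exists q y, monomial_ideal [seq f b | b <- s] q /\ p = q + y * 'X_[f a].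
  by apply: iff_trans (IE p) _; apply: monomial_ideal_cons.
have gr_u : graded_entry 0 (mdeg (f a)) ('X_[f a] : S).
  by rewrite /graded_entry supp_inX add0n.
have [C [bC aC]] := mapping_cone G F gr_u colon sum (leqnSn _) (ltnSn _).
(* For the [G]-part, the strict growth of the lcm degree pays for the extra generator in the size.
   For the [F]-part, the twist matches [D_cons] and the homological shift pays. *)
have lt_D := lcm_deg_lt faa fba; have D_cons := lcm_deg_cons a s f.
exists C; rewrite bC aC; split=> [||i j].
- by rewrite /= gfr_len // add0n.
- by rewrite /= gfr_len //= subnn aF D_cons.
case: i => [|i] /=.
  by move=> /leG; lia.
case: (ltnP j (gfr_b G i.+1)) => [lt_j _ | le_j lt_j].
  by have := leG _ _ lt_j; lia.
have := leF i (j - gfr_b G i.+1)%N; lia.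
Qed.

End MonomialIdeals.

(** * Vertex covers, independent sets and neighborhood monomials *)

Lemma bigminn_leq (J : eqType) (r : seq J) (P : pred J) (F : J -> nat) x j :
  j \in r -> P j -> (\big[minn/x]_(i <- r | P i) F i <= F j)%N.
Proof.
elim: r => // i r IHr; rewrite in_cons big_cons => /predU1P[<- -> | rj Pj].
  exact: geq_minl.
by case: (P i); rewrite ?(leq_trans (geq_minr _ _)) ?IHr.
Qed.

Section Graph.
Variables (n : nat) (e : rel 'I_n).
Implicit Types (A B C : {set 'I_n}) (v w : 'I_n).

Lemma vertex_coverC C : vertex_cover e C = independent e (~: C).
Proof.
apply: eq_forallb => v; rewrite inE; case: (v \in C) => /=.
  by apply/forallP => w; rewrite implybT.
by apply: eq_forallb => w; rewrite inE; case: (e v w); case: (w \in C).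
Qed.

(** Gallai's identity: complementation exchanges covers and independent sets. The default [n] of the
    minimum respects the lower bound. *)
Lemma tauE : tau e = (n - alpha e)%N.
Proof.
apply/eqP; rewrite eqn_leq; apply/andP; split; last first.
  apply: (big_ind (fun t => n - alpha e <= t)%N) => [|x y le_x le_y|C covC].
  - exact: leq_subr.
  - by rewrite leq_min le_x.
  rewrite leq_subLR addnC -leq_subLR.
  have -> : (n - #|C| = #|~: C|)%N by rewrite [RHS]cardsCs setCK card_ord.
  by apply: (@leq_bigmax_cond _ _ (fun A : {set 'I_n} => #|A|)); rewrite -vertex_coverC.
have ind0 : independent e set0 by apply/forall_inP => v; rewrite inE.
have [B indB ->] : exists2 B : {set 'I_n}, independent e B & alpha e = #|B|.
  have [|B indB maxB] := @eq_bigmax_cond _ (independent e) (fun B : {set 'I_n} => #|B|).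
    by apply/card_gt0P; exists set0.
  by exists B.
have -> : (n - #|B| = #|~: B|)%N by rewrite [RHS]cardsCs setCK card_ord.
by apply: bigminn_leq; rewrite ?mem_index_enum // vertex_coverC setCK.
Qed.

Definition nbhd_mnm v : 'X_{1..n} := [multinom (w \in closed_nbhd e v) : nat | w < n].

Lemma nbhd_mnmE v w : nbhd_mnm v w = (w \in closed_nbhd e v).
Proof. exact: mnmE. Qed.

Lemma u_nbhdE (K : fieldType) v : u_nbhd K e v = 'X_[nbhd_mnm v].
Proof.
rewrite mpolyXE_id [RHS](bigID (mem (closed_nbhd e v))) /=.
rewrite [X in _ * X]big1 => [|w /negPf nw]; last by rewrite nbhd_mnmE nw expr0.
by rewrite mulr1; apply: eq_bigr => w vw; rewrite nbhd_mnmE vw expr1.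
Qed.

(** Links generation by coefficients to the support test: each monomial of [p] is absorbed by one
    generator dividing it. *)
Lemma ideal_genX (K : fieldType) (P : pred 'I_n) (f : 'I_n -> 'X_{1..n}) p :
  ideal_gen P (fun v => 'X_[K, f v]) p <->
  monomial_ideal [seq f v | v <- enum P] p.
Proof.
split=> [[c ->] | /supp_inP Ip].
  rewrite -big_enum; apply: supp_in_sum => v; rewrite mem_enum => Pv.
  rewrite supp_inMX; apply/supp_inP => m _; apply/hasP; exists (f v).
    by rewrite map_f ?mem_enum.
  exact: lem_addr.
rewrite [p]mpolyE big_seq; apply: (big_ind (ideal_gen P (fun v => 'X_[K, f v]))).
- by exists (fun _ => 0); rewrite big1 // => v _; rewrite mul0r.
- move=> p1 p2 [c1 ->] [c2 ->]; exists (fun v => c1 v + c2 v).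
  by rewrite -big_split; apply: eq_bigr => v _; rewrite mulrDl.
move=> m /Ip /hasP[_ /mapP[v Pv ->] le_vm].
rewrite mem_enum in Pv.
exists (fun w => if w == v then p@_m *: 'X_[m - f v] else 0).
rewrite (bigD1 v) //= eqxx big1 => [|w /andP[_ /negPf ->]]; last by rewrite mul0r.
by rewrite addr0 -scalerAl -mpolyXD submK.
Qed.

End Graph.

(** * Projective dimension and regularity of the closed neighborhood ideal *)

Theorem theorem3p6 (K : fieldType) (n : nat) (e : rel 'I_n) :
  infinite_field K ->
  simple_graph e ->
  (exists A : {set 'I_n}, independent e A /\
     forall p : {mpoly K[n]}, @NI K n e p <-> ideal_gen (mem A) (u_nbhd K e) p) ->
  exists s : seq 'X_{1..n},
    uniq s /\ (forall m, m \in s <-> min_mon_gen (@NI K n e) m) /\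
    (* (a) pd(S/NI(G)) = alpha(G) = |G(NI(G))| *)
    (is_pd (@NI K n e) (alpha e) /\ alpha e = size s) /\
    (* (b) reg(S/NI(G)) = tau(G) = n - |G(NI(G))| *)
    (is_reg (@NI K n e) (tau e) /\ tau e = (n - size s)%N).
Proof.
move=> _ simple_e [A [indA NIE]]; have [irr_e sym_e] := simple_e.
have {}NIE p : @NI K n e p <-> monomial_ideal [seq nbhd_mnm e a | a <- enum A] p.
  apply: iff_trans (NIE p) _; rewrite -ideal_genX /ideal_gen.
  by split=> -[c ->]; exists c; apply: eq_bigr => v _; rewrite u_nbhdE.
have NIX m : @NI K n e 'X_[m] <-> exists2 a, a \in A & (nbhd_mnm e a <= m)%MM.
  apply: iff_trans (NIE _) _; rewrite /monomial_ideal supp_inX has_map.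
  by split=> [/hasP[a] | [a Aa le_a]];
    [rewrite mem_enum; exists a | apply/hasP; exists a; rewrite ?mem_enum].
have f_priv : {in enum A &, forall a b, nbhd_mnm e a b = (a == b)}.
  move=> a b; rewrite !mem_enum => Aa Ab; rewrite nbhd_mnmE inE eq_sym.
  by rewrite (negPf (forall_inP (forall_inP indA a Aa) b Ab)) orbF.
have f_le a b : a \in A -> b \in A -> (nbhd_mnm e a <= nbhd_mnm e b)%MM -> a = b.
  move=> Aa Ab /mnm_lepP/(_ a); rewrite !f_priv ?mem_enum // eqxx eq_sym.
  by case: eqP.
(* The monomial of [v] lies in the ideal, so a generator indexed by [A] divides it. *)
have domA v : exists2 a, a \in A & closed_nbhd e a \subset closed_nbhd e v.
  have /NIX[a Aa /mnm_lepP le_av] : @NI K n e 'X_[nbhd_mnm e v].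
    exists (fun w => (w == v)%:R); rewrite (bigD1 v) //= eqxx mul1r u_nbhdE.
    by rewrite big1 ?addr0 // => w /negPf ->; rewrite mul0r.
  exists a => //; apply/subsetP => w aw; move: (le_av w); rewrite !nbhd_mnmE aw.
  by case: (w \in _).
have alphaE : alpha e = #|A|.
  apply/eqP; rewrite eqn_leq; apply/andP; split; last first.
    exact: (@leq_bigmax_cond _ _ (fun B : {set 'I_n} => #|B|)).
  apply/bigmax_leqP => B indB; have [pi Api sub_pi] := fin_all_exists2 domA.
  have pi_inj : {in B &, injective pi}.
    move=> v w Bv Bw eq_pi; apply/eqP; have : w \in closed_nbhd e v.
      apply: (subsetP (sub_pi v)); rewrite inE sym_e eq_sym eq_pi.
      by have /subsetP/(_ (pi w)) := sub_pi w; rewrite !inE eqxx => /(_ isT).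
    rewrite inE (negPf (forall_inP (forall_inP indB v Bv) w Bw)) orbF.
    by rewrite eq_sym.
  rewrite -(card_in_imset pi_inj); apply/subset_leq_card/subsetP => _ /imsetP[v _ ->].
  exact: Api.
(* By [domA] and symmetry the set [A] dominates the graph, so the squarefree generators have the
   product of all variables as lcm. *)
have lcmE : lcm_deg (enum A) (nbhd_mnm e) = n.
  rewrite /lcm_deg -[RHS]card_ord -sum1_card; apply: eq_bigr => w _.
  apply/eqP; rewrite eqn_leq; apply/andP; split.
    by apply/bigmax_leqP_seq => a _ _; rewrite nbhd_mnmE leq_b1.
  have [a Aa /subsetP/(_ a)] := domA w; rewrite !inE eqxx => /(_ isT) wa.
  apply: (bigmax_sup_seq a) => //; rewrite ?mem_enum // nbhd_mnmE !inE.
  by rewrite eq_sym sym_e wa.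
have sizeA : size (enum A) = #|A| by rewrite -cardE.
exists [seq nbhd_mnm e a | a <- enum A]; rewrite size_map sizeA tauE alphaE.
split; first rewrite map_inj_in_uniq ?enum_uniq //.
  by move=> a b; rewrite !mem_enum => Aa Ab eq_f; apply: f_le; rewrite ?eq_f ?lepm_refl.
split.
  move=> m; split=> [/mapP[a Aa ->] | [/NIX[a Aa le_a] min_m]].
    rewrite mem_enum in Aa; split; first by apply/NIX; exists a; rewrite ?lepm_refl.
    move=> m' /NIX[b Ab le_b] /mnm_lepP le_m'.
    have eq_ba := f_le _ _ Ab Aa (lepm_trans le_b le_m').
    apply/mnmP => i; apply/eqP; rewrite eqn_leq (mnm_lepP le_m') -eq_ba.
    exact: (mnm_lepP le_b).
  rewrite -(min_m (nbhd_mnm e a)); first by rewrite map_f ?mem_enum.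
    by apply/NIX; exists a; rewrite ?lepm_refl.
  exact/mnm_lepP.
have [T [bT aT leT]] := private_variables_res (enum_uniq A) f_priv NIE.
rewrite {}lcmE {}sizeA in T bT aT leT *.
have bound l (F : graded_free_res (@NI K n e) l) : (0 < #|A|)%N ->
    exists2 j, (j < gfr_b F #|A|)%N & (n <= gfr_a F #|A| j)%N.
  move=> A_gt0; have j0lt : (0 < gfr_b T #|A|)%N by rewrite bT.
  have [|j|j ltj] := top_degree_bound F (j0 := Ordinal j0lt) A_gt0.
  - exact: gfr_len.
  - case: j => j ltj /=; rewrite aT -(ltn_add2r #|A|).
    by apply: leq_ltn_trans (leT _ _ ltj) _; rewrite ltn_add2l prednK.
  by rewrite /= aT; exists j.
have leAn : (#|A| <= n)%N by rewrite -[X in (_ <= X)%N](card_ord n) max_card.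
split; split=> //.
  split=> [|q [F]]; first by exists.
  case: (posnP #|A|) => [-> // | /(bound _ F)[j]].
  by case: (leqP #|A| q) => // lt_q; rewrite (gfr_len F lt_q).
split=> [|r [l [F leF]]].
  exists #|A|, T => i j /leT; lia.
(* If [A] is empty, the top shift [n] of [T] is its shift in degree 0, so [n = 0]. *)
case: (posnP #|A|) => [A0 | /(bound _ F)[j /leF]]; last lia.
by rewrite -[X in (X - _)%N]aT [X in gfr_a T X]A0 gfr_a0.
Qed.
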